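(* Let $f:\mathbb{R}^n\to\mathbb{R}$ be differentiable and bounded from below, and let $c>0$ be such that $f(\theta)+c>0$ for all $\theta\in\mathbb{R}^n$. Put $g(\theta)=\sqrt{f(\theta)+c}$. (i) The global AEGD iteration with initial point $\theta_0\in\mathbb{R}^n$ is unconditionally energy stable in the sense that for any step size $\eta>0$ and all $k\ge 0$, $$r_{k+1}^2=r_k^2-(r_{k+1}-r_k)^2-\eta^{-1}\|\theta_{k+1}-\theta_k\|^2;$$ moreover $r_k$ is strictly decreasing and convergent, $r_k\to r^*$ as $k\to\infty$, and $$\lim_{k\to\infty}\|\theta_{k+1}-\theta_k\|=0,\qquad \sum_{j=0}^\infty\|\theta_{j+1}-\theta_j\|^2\le \eta\,(r_0^2-(r^* )^2).$$ (ii) The element-wise AEGD iteration with initial point $\theta_0\in\mathbb{R}^n$ is unconditionally energy stable in the sense that for any step size $\eta>0$, all $k\ge 0$ and all $i\in[n]$, $$r_{k+1,i}^2=r_{k,i}^2-(r_{k+1,i}-r_{k,i})^2-\eta^{-1}(\theta_{k+1,i}-\theta_{k,i})^2;$$ moreover, for each $i\in[n]$, $r_{k,i}$ is strictly decreasing in $k$ and convergent, $r_{k,i}\to r_i^*$ as $k\to\infty$, and $$\lim_{k\to\infty}\|\theta_{k+1}-\theta_k\|=0,\qquad \sum_{j=0}^\infty\|\theta_{j+1}-\theta_j\|^2\le \eta\sum_{i=1}^n\big(r_{0,i}^2-(r_i^* )^2\big).$$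
   Context: Here $[n]=\{1,\dots,n\}$, $\|\cdot\|$ is the $\ell_2$-norm, and $\partial_i=\partial_{\theta_i}$. Global AEGD: given $\theta_0\in\mathbb{R}^n$ and $\eta>0$, set $r_0=\sqrt{f(\theta_0)+c}$ and, for $k=0,1,2,\dots$, $$r_{k+1}=\frac{r_k}{1+2\eta\|\nabla g(\theta_k)\|^2},\qquad \theta_{k+1}=\theta_k-2\eta\, r_{k+1}\nabla g(\theta_k).$$ Element-wise AEGD: given $\theta_0\in\mathbb{R}^n$ and $\eta>0$, set $r_{0,i}=\sqrt{f(\theta_0)+c}$ for $i\in[n]$ and, for $k=0,1,2,\dots$ and $i\in[n]$, $$r_{k+1,i}=\frac{r_{k,i}}{1+2\eta(\partial_i g(\theta_k))^2},\qquad \theta_{k+1,i}=\theta_{k,i}-2\eta\, r_{k+1,i}\,\partial_i g(\theta_k),$$ where $\theta_{k,i}$ is the $i$-th coordinate of $\theta_k$.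
   Formalization: ''Strictly decreasing'' fails when the gradient of g (resp. its i-th partial derivative) vanishes at θ_k, e.g. for constant f; instead r_k (resp. r_{k,i}) is shown nonincreasing, with strict decrease at step k exactly when that derivative is nonzero. *)

(* Defs.v *)
From HB Require Import structures.
From mathcomp Require Import all_boot all_order all_algebra.
From mathcomp Require Import all_classical all_reals all_analysis.

Set Implicit Arguments.
Unset Strict Implicit.
Unset Printing Implicit Defensive.

Import Order.TTheory GRing.Theory Num.Theory.
Import numFieldNormedType.Exports.

Local Open Scope classical_set_scope.
Local Open Scope ring_scope.

(* The canonical norm `|x| on 'rV[R]_n is the sup-norm, hence this definition. *)
Definition norm2 (R : realType) (n : nat) (x : 'rV[R]_n) : R :=
  Num.sqrt (\sum_(i < n) x 0 i ^+ 2).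

Definition partial (R : realType) (n : nat) (g : 'rV[R]_n -> R) (i : 'I_n)
    (theta : 'rV[R]_n) : R :=
  'D_(delta_mx 0 i) g theta.

Definition grad (R : realType) (n : nat) (g : 'rV[R]_n -> R)
    (theta : 'rV[R]_n) : 'rV[R]_n :=
  \row_(i < n) partial g i theta.

Definition sqrt_shift (R : realType) (n : nat) (f : 'rV[R]_n -> R) (c : R)
    (theta : 'rV[R]_n) : R :=
  Num.sqrt (f theta + c).

(* State (theta_k, r_k) of the global iteration. *)
Fixpoint global_aegd (R : realType) (n : nat) (f : 'rV[R]_n -> R) (c eta : R)
    (theta0 : 'rV[R]_n) (k : nat) : 'rV[R]_n * R :=
  if k is k'.+1 then
    let: (theta, r) := global_aegd f c eta theta0 k' in
    let d := grad (sqrt_shift f c) theta in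
    let r' := r / (1 + 2 * eta * norm2 d ^+ 2) in
    (theta - (2 * eta * r') *: d, r')
  else (theta0, Num.sqrt (f theta0 + c)).

(* State (theta_k, (r_{k,i})_i) of the element-wise iteration. *)
Fixpoint elementwise_aegd (R : realType) (n : nat) (f : 'rV[R]_n -> R)
    (c eta : R) (theta0 : 'rV[R]_n) (k : nat) : 'rV[R]_n * 'rV[R]_n :=
  if k is k'.+1 then
    let: (theta, r) := elementwise_aegd f c eta theta0 k' in
    let r' := \row_(i < n)
      (r 0 i / (1 + 2 * eta * partial (sqrt_shift f c) i theta ^+ 2)) in
    (\row_(i < n)
       (theta 0 i - 2 * eta * r' 0 i * partial (sqrt_shift f c) i theta), r')
  else (theta0, \row_(i < n) Num.sqrt (f theta0 + c)).

(* Main.v *)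
(* Writing q for the squared derivative driving an update, the implicit rule
   r' (1 + 2 eta q) = r gives r - r' = 2 eta q r', whence
   r^2 - r'^2 - (r - r')^2 = 2 r' (r - r') = 4 eta q r'^2, and the right-hand
   side is eta^-1 times the squared displacement of theta. Hence the squared
   displacement is at most eta (r^2 - r'^2), which telescopes; r decreases and
   stays positive, so it converges. *)

Require Import Defs.
From HB Require Import structures.
From mathcomp Require Import all_boot all_order all_algebra.
From mathcomp Require Import all_classical all_reals all_analysis.
From mathcomp Require Import ring.

Set Implicit Arguments.
Unset Strict Implicit.
Unset Printing Implicit Defensive.

Import Order.TTheory GRing.Theory Num.Theory.
Import numFieldNormedType.Exports.

Local Open Scope classical_set_scope.
Local Open Scope ring_scope.

Section Norm2.
Variables (R : realType) (n : nat).
Implicit Types x : 'rV[R]_n.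

Lemma norm2_ge0 x : 0 <= norm2 x.
Proof. exact: sqrtr_ge0. Qed.

Lemma norm2_sqr x : norm2 x ^+ 2 = \sum_(i < n) x 0 i ^+ 2.
Proof. by rewrite sqr_sqrtr // sumr_ge0 // => i _; exact: sqr_ge0. Qed.

Lemma norm2Z_sqr (a : R) x : norm2 (a *: x) ^+ 2 = a ^+ 2 * norm2 x ^+ 2.
Proof.
rewrite !norm2_sqr mulr_sumr; apply: eq_bigr => i _.
by rewrite mxE exprMn.
Qed.

(** A sum of squares vanishes only termwise. This turns the scalar condition [q != 0] for strict
    decrease into a nonzero gradient. *)
Lemma norm2_sqr_eq0 x : (norm2 x ^+ 2 == 0) = (x == 0).
Proof.
rewrite norm2_sqr psumr_eq0; last by move=> i _; exact: sqr_ge0.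
apply/allP/eqP => [x0|-> i _]; last by rewrite mxE expr0n eqxx.
apply/rowP => i; rewrite mxE; apply/eqP.
by rewrite -sqrf_eq0; apply: x0; rewrite mem_index_enum.
Qed.

End Norm2.

Section EnergyStep.
Variables (R : realType) (eta q r : R).
Hypotheses (eta_gt0 : 0 < eta) (q_ge0 : 0 <= q).
Let r' := r / (1 + 2 * eta * q).

Let den_gt0 : 0 < 1 + 2 * eta * q.
Proof. by rewrite ltr_pwDl // !mulr_ge0 // ltW. Qed.

(** One scalar identity serves both iterations: [q] stands for the squared norm of the gradient or
    for one squared partial derivative, and [(2 * eta * r') ^+ 2 * q] is the squared
    displacement. *)
Lemma energy_step_eq :
  r' ^+ 2 = r ^+ 2 - (r' - r) ^+ 2 - eta^-1 * ((2 * eta * r') ^+ 2 * q).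
Proof. by rewrite /r'; field; rewrite (gt_eqF eta_gt0) (gt_eqF den_gt0). Qed.

Lemma energy_step_gt0 : 0 < r -> 0 < r'.
Proof. by move=> r_gt0; rewrite divr_gt0. Qed.

Lemma energy_step_le : 0 < r -> r' <= r.
Proof.
move=> r_gt0; rewrite ler_pdivrMr // ler_peMr ?(ltW r_gt0) //.
by rewrite lerDl !mulr_ge0 // ltW.
Qed.

(** For positive [r], the division lowers it exactly when the denominator exceeds 1, that is, when
    [q > 0]. *)
Lemma energy_step_lt : 0 < r -> (r' < r) = (q != 0).
Proof.
move=> r_gt0; rewrite ltr_pdivrMr // ltr_pMr // ltrDl pmulr_rgt0 ?mulr_gt0 //.
by rewrite lt_neqAle q_ge0 andbT eq_sym.
Qed.

End EnergyStep.

Lemma energy_dissipation (R : realType) (eta r r' d : R) : 0 < eta ->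
  r' ^+ 2 = r ^+ 2 - (r' - r) ^+ 2 - eta^-1 * d ->
  d <= eta * (r ^+ 2 - r' ^+ 2).
Proof.
move=> eta_gt0 E; rewrite -ler_pdivrMl // {}E.
by rewrite [leRHS](_ : _ = (r' - r) ^+ 2 + eta^-1 * d) ?lerDr ?sqr_ge0 //; ring.
Qed.

Lemma nonincreasing_gt0_cvg (R : realType) (u : R^nat) :
  nonincreasing_seq u -> (forall k, 0 < u k) -> exists l : R, u @ \oo --> l.
Proof.
move=> u_dec u_gt0; exists (limn u).
apply: nonincreasing_is_cvgn => //.
by exists 0 => _ [k _ <-]; exact: ltW.
Qed.

Section Dissipation.
Variables (R : realType) (eta l : R) (E s : R^nat).
Hypotheses (eta_gt0 : 0 < eta) (E_cvg : E @ \oo --> l).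
Hypothesis s_le : forall k, s k ^+ 2 <= eta * (E k - E k.+1).

Let E_dec : nonincreasing_seq E.
Proof.
apply/nonincreasing_seqP => k; rewrite -subr_ge0 -(pmulr_rge0 _ eta_gt0).
exact: le_trans (sqr_ge0 _) (s_le k).
Qed.

(** The squares [s k ^+ 2] are squeezed between 0 and [eta] times a consecutive difference of a
    convergent sequence; continuity of the square root carries this over to [s]. *)
Lemma dissipation_cvg0 : (forall k, 0 <= s k) -> s @ \oo --> (0 : R).
Proof.
move=> s_ge0.
have s2_cvg : s k ^+ 2 @[k --> \oo] --> (0 : R).
  apply: (@squeeze_cvgr _ _ _ _ (fun=> 0) (fun k => eta * (E k - E k.+1))).
  - by near=> k; rewrite sqr_ge0 s_le.
  - exact: cvg_cst.
  - rewrite -(mulr0 eta) -(subrr l); apply: cvgMl_tmp; apply: cvgB => //.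
    by rewrite (cvg_shiftS E).
have -> : s = Num.sqrt \o (fun k => s k ^+ 2).
  by apply/funext => k /=; rewrite sqrtr_sqr ger0_norm.
rewrite -(sqrtr0 R); apply: continuous_cvg s2_cvg; exact: sqrt_continuous.
Unshelve. all: by end_near. Qed.

(** Partial sums telescope to at most [eta * (E 0 - E k)], and the nonincreasing [E] stays above its
    limit [l]. *)
Lemma dissipation_sum :
  (\sum_(0 <= j <oo) (s j ^+ 2)%:E <= (eta * (E 0%N - l))%:E)%E.
Proof.
apply: lime_le; first by apply: is_cvg_nneseries => k _ _; rewrite lee_fin sqr_ge0.
near=> k; rewrite sumEFin lee_fin.
apply: (@le_trans _ _ (\sum_(0 <= j < k) eta * (E j - E j.+1))).
  exact: ler_sum.
(* Telescoping works on increments [u j.+1 - u j], hence the choice [u = - E]. *)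
rewrite -mulr_sumr ler_pM2l // (@telescope_sumr_eq _ _ _ (\- E)) //=.
  rewrite opprK addrC lerB // -(cvg_lim _ E_cvg) //.
  by apply: nonincreasing_cvgn_ge => //; apply/cvg_ex; exists l.
by move=> j _; rewrite opprK addrC.
Unshelve. all: by end_near. Qed.

End Dissipation.

(* "Strictly decreasing" fails at a step where the gradient (resp. the i-th
   partial derivative) of g vanishes, since then r is unchanged by the update.
   It is stated as: nonincreasing, and strict at step k exactly when the
   derivative driving the update at theta_k is nonzero. *)
Theorem theorem3p1 (R : realType) (n : nat) (f : 'rV[R]_n -> R) (c : R)
    (f_diff : forall theta : 'rV[R]_n, differentiable f theta)
    (f_lb : exists m : R, forall theta : 'rV[R]_n, m <= f theta)
    (c_gt0 : 0 < c)
    (fc_gt0 : forall theta : 'rV[R]_n, 0 < f theta + c) :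
  let g := sqrt_shift f c in
  (forall (theta0 : 'rV[R]_n) (eta : R), 0 < eta ->
    let theta := fun k : nat => (global_aegd f c eta theta0 k).1 in
    let r := fun k : nat => (global_aegd f c eta theta0 k).2 in
    [/\ forall k : nat,
          r k.+1 ^+ 2 = r k ^+ 2 - (r k.+1 - r k) ^+ 2
                        - eta^-1 * norm2 (theta k.+1 - theta k) ^+ 2,
        nonincreasing_seq r,
        forall k : nat, r k.+1 < r k <-> grad g (theta k) <> 0,
        norm2 (theta k.+1 - theta k) @[k --> \oo] --> (0 : R)
      & exists rstar : R,
          r k @[k --> \oo] --> rstar /\
          (\sum_(0 <= j <oo) (norm2 (theta j.+1 - theta j) ^+ 2)%:E
             <= (eta * (r 0%N ^+ 2 - rstar ^+ 2))%:E)%E])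
  /\
  (forall (theta0 : 'rV[R]_n) (eta : R), 0 < eta ->
    let theta := fun k : nat => (elementwise_aegd f c eta theta0 k).1 in
    let r := fun (k : nat) (i : 'I_n) =>
      (elementwise_aegd f c eta theta0 k).2 0 i in
    [/\ forall (k : nat) (i : 'I_n),
          r k.+1 i ^+ 2 = r k i ^+ 2 - (r k.+1 i - r k i) ^+ 2
                          - eta^-1 * (theta k.+1 0 i - theta k 0 i) ^+ 2,
        forall i : 'I_n, nonincreasing_seq (fun k : nat => r k i),
        forall (k : nat) (i : 'I_n),
          r k.+1 i < r k i <-> partial g i (theta k) <> 0,
        norm2 (theta k.+1 - theta k) @[k --> \oo] --> (0 : R)
      & exists rstar : 'I_n -> R,
          (forall i : 'I_n, r k i @[k --> \oo] --> rstar i) /\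
          (\sum_(0 <= j <oo) (norm2 (theta j.+1 - theta j) ^+ 2)%:E
             <= (eta * \sum_(i < n) (r 0%N i ^+ 2 - rstar i ^+ 2))%:E)%E]).
Proof.
move=> g; split=> theta0 eta eta_gt0 theta r.
- pose q k := norm2 (grad g (theta k)) ^+ 2.
  have q_ge0 k : 0 <= q k by exact: sqr_ge0.
  have rS k : r k.+1 = r k / (1 + 2 * eta * q k).
    by rewrite /q /r /theta /=; case: global_aegd.
  have thetaS k : theta k.+1 - theta k = - (2 * eta * r k.+1) *: grad g (theta k).
    rewrite /r /theta /=; case: global_aegd => t s /=.
    by rewrite addrC addKr scaleNr.
  (* Positivity starts from [f theta0 + c > 0] and survives each division by a positive
     denominator. *)
  have r_gt0 k : 0 < r k.
    elim: k => [|k IH]; first by rewrite sqrtr_gt0.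
    by rewrite rS energy_step_gt0.
  have energy k : r k.+1 ^+ 2 = r k ^+ 2 - (r k.+1 - r k) ^+ 2
                        - eta^-1 * norm2 (theta k.+1 - theta k) ^+ 2.
    by rewrite thetaS norm2Z_sqr sqrrN rS; exact: energy_step_eq.
  have r_dec : nonincreasing_seq r.
    by apply/nonincreasing_seqP => k; rewrite rS energy_step_le.
  have [l r_cvg] := nonincreasing_gt0_cvg r_dec r_gt0.
  (* In the global case the dissipated energy [E] is [r ^+ 2]. *)
  have E_cvg : r k ^+ 2 @[k --> \oo] --> l ^+ 2 by exact: cvgM.
  have s_le k := energy_dissipation eta_gt0 (energy k).
  split=> //.
  + move=> k; rewrite rS energy_step_lt // norm2_sqr_eq0.
    by split=> /eqP.
  + exact: dissipation_cvg0 E_cvg s_le (fun k => norm2_ge0 _).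
  + by exists l; split=> //; exact: dissipation_sum eta_gt0 E_cvg s_le.
- pose q k i := partial g i (theta k) ^+ 2.
  have q_ge0 k i : 0 <= q k i by exact: sqr_ge0.
  have rS k i : r k.+1 i = r k i / (1 + 2 * eta * q k i).
    by rewrite /q /r /theta /=; case: elementwise_aegd => t s; rewrite mxE.
  have thetaS k i : theta k.+1 0 i - theta k 0 i =
      - (2 * eta * r k.+1 i * partial g i (theta k)).
    rewrite /r /theta /=; case: elementwise_aegd => t s /=.
    by rewrite [in LHS]mxE addrC addKr.
  have r_gt0 i k : 0 < r k i.
    elim: k => [|k IH]; first by rewrite /r mxE sqrtr_gt0.
    by rewrite rS energy_step_gt0.
  have energy k i : r k.+1 i ^+ 2 = r k i ^+ 2 - (r k.+1 i - r k i) ^+ 2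
                        - eta^-1 * (theta k.+1 0 i - theta k 0 i) ^+ 2.
    by rewrite thetaS sqrrN exprMn rS; exact: energy_step_eq.
  have r_dec i : nonincreasing_seq (r^~ i).
    by apply/nonincreasing_seqP => k; rewrite rS energy_step_le.
  have [l r_cvg] := choice (fun i => nonincreasing_gt0_cvg (r_dec i) (r_gt0 i)).
  (* The displacement norm involves all coordinates at once, so [E] is now the total energy over
     [i], with limit the sum of the squared coordinate limits. *)
  have E_cvg : \sum_(i < n) r k i ^+ 2 @[k --> \oo] --> \sum_(i < n) l i ^+ 2.
    by apply: cvg_big => [|i _]; [exact: add_continuous | apply: cvgM]; exact: r_cvg.
  (* The coordinatewise dissipation bounds are added up over [i]. *)
  have s_le k : norm2 (theta k.+1 - theta k) ^+ 2 <=
      eta * (\sum_(i < n) r k i ^+ 2 - \sum_(i < n) r k.+1 i ^+ 2).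
    rewrite norm2_sqr -sumrB mulr_sumr; apply: ler_sum => i _.
    by rewrite !mxE; exact: energy_dissipation (energy k i).
  split=> //.
  + move=> k i; rewrite rS energy_step_lt // sqrf_eq0.
    by split=> /eqP.
  + exact: dissipation_cvg0 E_cvg s_le (fun k => norm2_ge0 _).
  + exists l; split=> //; rewrite sumrB.
    exact: dissipation_sum eta_gt0 E_cvg s_le.
Qed.
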